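(* Let $m\ge 2$ and $\alpha$ be positive integers and let $a>0$. Let $A$ be the $m\times m$ matrix with entries $A_{k,k}=a$, $A_{k,l}=\alpha$ for $k<l$, and $A_{k,l}=1$ for $k>l$, i.e. \[ A=\begin{pmatrix} a&\alpha&\alpha&\cdots&\alpha\\ 1&a&\alpha&\cdots&\alpha\\ 1&1&a&\cdots&\alpha\\ \vdots&\vdots&\vdots&\ddots&\vdots\\ 1&1&1&\cdots&a \end{pmatrix}. \] Let $A_{n,i,j}$ denote the $(i,j)$ entry of $A^n$. Then for all $1\le i,j,u,v\le m$, \[ \lim_{n\to\infty}\frac{A_{n,i,j}}{A_{n,u,v}}=\alpha^{(j+u-i-v)/m}. \] *)

(* Defs.v *)
From HB Require Import structures.
From mathcomp Require Import all_boot all_order all_algebra.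
From mathcomp Require Import all_classical all_reals all_analysis.

Set Implicit Arguments.
Unset Strict Implicit.
Unset Printing Implicit Defensive.

Import Order.TTheory GRing.Theory Num.Theory.

Local Open Scope ring_scope.

Definition two_value_mx (R : realType) (m alpha : nat) (a : R) : 'M[R]_m :=
  \matrix_(k < m, l < m)
    if k == l then a else if (k < l)%N then alpha%:R else 1.

(* Main.v *)
(* With [t = alpha ^ (1/m)] and [D = diag (t ^ k)], the matrix [C = D A D^-1] is
   circulant, because going once around the cycle multiplies by [t ^ m = alpha].
   It has positive entries and constant row and column sums [s], so [C ^ n / s ^ n]
   tends entrywise to [1/m]: subtracting a small multiple of the all-ones matrix
   from [C] leaves a nonnegative matrix with row sums [< s].  Hence the entry
   [(i, j)] of [A ^ n] is equivalent to [s ^ n * t ^ (j - i) / m]. *)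
Require Import Defs.
From HB Require Import structures.
From mathcomp Require Import all_boot all_order all_algebra.
From mathcomp Require Import all_classical all_reals all_analysis.
From mathcomp Require Import ring zify.

Set Implicit Arguments.
Unset Strict Implicit.
Unset Printing Implicit Defensive.

Import Order.TTheory GRing.Theory Num.Theory.
Import numFieldNormedType.Exports.

Local Open Scope classical_set_scope.
Local Open Scope ring_scope.

Lemma row_sum_exprmx (R : pzRingType) (m : nat) (B : 'M[R]_m) (q : R) :
  (forall i, \sum_j B i j = q) -> forall n i, \sum_j (B ^+ n) i j = q ^+ n.
Proof.
move=> Bq; elim=> [|n IHn] i.
  rewrite expr0 (bigD1 i) //= mxE eqxx big1 ?addr0 // => j ji.
  by rewrite mxE eq_sym (negbTE ji).
rewrite exprSr; under eq_bigr do rewrite mxE.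
rewrite exchange_big /=.
under eq_bigr do rewrite -big_distrr /= Bq.
by rewrite -mulr_suml IHn exprSr.
Qed.

Lemma exprmx_ge0 (R : numDomainType) (m : nat) (B : 'M[R]_m) :
  (forall i j, 0 <= B i j) -> forall n i j, 0 <= (B ^+ n) i j.
Proof.
move=> B0; elim=> [|n IHn] i j; first by rewrite expr0 mxE mulrn_wge0.
by rewrite exprSr mxE sumr_ge0 // => k _; rewrite mulr_ge0.
Qed.

Lemma row_sum_sub_const (R : pzRingType) (m : nat) (C : 'M[R]_m) (s e : R) :
  (forall i, \sum_j C i j = s) ->
  forall i, \sum_j (C - const_mx e) i j = s - m%:R * e.
Proof.
move=> Cr i; under eq_bigr do rewrite !mxE.
by rewrite sumrB Cr sumr_const card_ord mulr_natl.
Qed.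

(* Row and column sums make the all-ones matrix [J = const_mx 1] satisfy
   [C J = J C = s J], and [J ^+ 2 = m J], so the difference is a multiple of [J]. *)
Lemma exprmx_sub_const (R : numFieldType) (m : nat) (C : 'M[R]_m) (s e : R) :
  (forall i, \sum_j C i j = s) -> (forall j, \sum_i C i j = s) ->
  forall n i j, (C ^+ n) i j = ((C - const_mx e) ^+ n) i j
                               + (s ^+ n - (s - m%:R * e) ^+ n) / m%:R.
Proof.
move=> Cr Cc n i j; have m0 : m%:R != 0 :> R.
  by rewrite pnatr_eq0 -lt0n (leq_ltn_trans _ (ltn_ord i)).
set B := C - const_mx e; set q := s - m%:R * e.
have Br k : \sum_l B k l = q.
  exact: row_sum_sub_const Cr k.
elim: n i j => [|n IHn] i j; first by rewrite !expr0 subrr mul0r addr0.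
rewrite exprSr mxE.
under eq_bigr do rewrite IHn mulrDl.
rewrite big_split /= -mulr_sumr Cc.
(* Each [C k j] is [B k j + e]; the constant [e] gets multiplied by a row sum of [B ^+ n], which is
   [q ^+ n]. *)
have -> : \sum_k (B ^+ n) i k * C k j = (B ^+ n.+1) i j + q ^+ n * e.
  rewrite exprSr mxE -(row_sum_exprmx Br n i) mulr_suml -big_split /=.
  by apply: eq_bigr => k _; rewrite -mulrDr !mxE subrK.
(* Since [m e = s - q], the sum [q ^ n e + s (s ^ n - q ^ n) / m] telescopes to
   [(s ^ n.+1 - q ^ n.+1) / m]. *)
rewrite -addrA; congr (_ + _); rewrite !exprS /q.
by field.
Qed.

Lemma cvg_exprmx_doubly_stochastic (R : realType) (m : nat) (C : 'M[R]_m)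
    (s e : R) : 0 < e -> (forall i j, e <= C i j) ->
  (forall i, \sum_j C i j = s) -> (forall j, \sum_i C i j = s) ->
  forall i j, (fun n => (C ^+ n) i j / s ^+ n) @ \oo --> (m%:R^-1 : R).
Proof.
move=> e0 eC Cr Cc i j.
have m0 : 0 < m%:R :> R by rewrite ltr0n (leq_ltn_trans _ (ltn_ord i)).
pose B := C - const_mx e; pose q := s - m%:R * e.
have Br k : \sum_l B k l = q.
  exact: row_sum_sub_const Cr k.
have B0 k l : 0 <= B k l by rewrite !mxE subr_ge0.
have q0 : 0 <= q by rewrite -(Br i) sumr_ge0.
have s0 : 0 < s.
  by apply: lt_le_trans (_ : m%:R * e <= s); rewrite ?mulr_gt0// -subr_ge0.
have qs_to0 : (fun n => (q / s) ^+ n) @ \oo --> (0 : R).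
  apply: cvg_expr; rewrite ger0_norm ?divr_ge0 ?(ltW s0)//.
  by rewrite ltr_pdivrMr// mul1r ltrBlDr ltrDl mulr_gt0.
(* As [B ^+ n] is nonnegative, each of its entries is at most the row sum [q ^+ n], and
   [0 <= q < s]. *)
have B_to0 : (fun n => (B ^+ n) i j / s ^+ n) @ \oo --> (0 : R).
  apply: (@squeeze_cvgr _ _ _ _ (fun=> 0) (fun n => (q / s) ^+ n)) => //.
    near=> n; rewrite divr_ge0 ?exprn_ge0 ?exprmx_ge0 ?(ltW s0)//=.
    rewrite expr_div_n ler_pM2r ?invr_gt0 ?exprn_gt0//.
    rewrite -(row_sum_exprmx Br n i) (bigD1 j)//= lerDl sumr_ge0// => k _.
    exact: exprmx_ge0.
  exact: cvg_cst.
have -> : (fun n => (C ^+ n) i j / s ^+ n)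
    = (fun n => (B ^+ n) i j / s ^+ n + (1 - (q / s) ^+ n) / m%:R).
  apply/funext => n; rewrite (exprmx_sub_const e Cr Cc) -/B -/q expr_div_n.
  have sn0 : s ^+ n != 0 by rewrite expf_neq0 ?gt_eqF.
  by field; rewrite sn0 gt_eqF.
rewrite [X in _ --> X](_ : _ = 0 + (1 - 0) / m%:R); last first.
  by rewrite add0r subr0 mul1r.
apply: (cvgD B_to0); apply: cvgMr_tmp.
by apply: cvgB qs_to0; exact: cvg_cst.
Unshelve. all: by end_near. Qed.

Lemma cvg_exprmx_entry_ratio (R : realType) (m : nat) (C : 'M[R]_m) (s e : R) :
  0 < e -> (forall i j, e <= C i j) ->
  (forall i, \sum_j C i j = s) -> (forall j, \sum_i C i j = s) ->
  forall i j u v,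
    (fun n => (C ^+ n) i j / (C ^+ n) u v) @ \oo --> (1 : R).
Proof.
move=> e0 eC Cr Cc i j u v.
have m0 : m%:R != 0 :> R.
  by rewrite pnatr_eq0 -lt0n (leq_ltn_trans _ (ltn_ord i)).
have s0 : s != 0.
  rewrite gt_eqF// -(Cr i) (bigD1 i)//= ltr_pwDl ?(lt_le_trans e0)//.
  by rewrite sumr_ge0// => k _; rewrite (le_trans (ltW e0)).
have -> : (fun n => (C ^+ n) i j / (C ^+ n) u v)
    = (fun n => (C ^+ n) i j / s ^+ n * ((C ^+ n) u v / s ^+ n)^-1).
  by apply/funext => n; rewrite invf_div mulrA divfK// expf_neq0.
(* Both normalized entries tend to the same nonzero limit [1/m], so [1] is written as the quotient
   of these limits. *)
rewrite -(@divff _ (m%:R^-1 : R)) ?invr_eq0//.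
apply: cvgM; first exact: cvg_exprmx_doubly_stochastic eC Cr Cc i j.
apply: cvgV; first by rewrite invr_eq0.
exact: cvg_exprmx_doubly_stochastic eC Cr Cc u v.
Qed.

(** With [D = diag x], the hypothesis reads [D A = C D], whence [D A ^ n = C ^ n D]. This
    division-free form of conjugation makes sense over any commutative ring. *)
Lemma exprmx_diag_conj (R : comPzRingType) (m : nat) (A C : 'M[R]_m)
    (x : 'I_m -> R) :
  (forall i j, A i j * x i = C i j * x j) ->
  forall n i j, (A ^+ n) i j * x i = (C ^+ n) i j * x j.
Proof.
move=> AC; elim=> [|n IHn] i j.
  by rewrite !expr0 !mxE; case: eqVneq => [->|]; rewrite // !mul0r.
rewrite !exprSr !mxE !mulr_suml; apply: eq_bigr => k _.
by rewrite mulrAC IHn -[LHS]mulrA [x k * _]mulrC AC mulrA.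
Qed.

(** The subtraction is that of the cyclic group ['I_p.+1], so indices wrap around modulo [p.+1]. *)
Definition circulant_mx (R : pzRingType) (p : nat) (w : 'I_p.+1 -> R) :
  'M[R]_p.+1 := \matrix_(k, l) w (k - l).

Lemma circulant_row_sum (R : pzRingType) (p : nat) (w : 'I_p.+1 -> R) k :
  \sum_l circulant_mx w k l = \sum_d w d.
Proof.
under eq_bigr do rewrite mxE.
by rewrite [RHS](reindex_inj (inv_inj (subKr k))).
Qed.

Lemma circulant_col_sum (R : pzRingType) (p : nat) (w : 'I_p.+1 -> R) l :
  \sum_k circulant_mx w k l = \sum_d w d.
Proof.
under eq_bigr do rewrite mxE.
by rewrite [RHS](reindex_inj (addIr (- l))).
Qed.

Lemma val_ord_sub (p : nat) (k l : 'I_p.+1) :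
  (k - l)%R = (if l <= k then k - l else p.+1 + k - l)%N :> nat.
Proof.
have kp := ltn_ord k; have lp := ltn_ord l.
rewrite /= modnDmr; case: leqP => lk.
  by rewrite addnBA ?(ltnW lp)// -addnBAC// modnDr modn_small; lia.
by rewrite modn_small; lia.
Qed.

(** Below the diagonal [t ^ (k - l) * t ^ l = t ^ k]. Above it, [k - l] wraps to [p.+1 + k - l], and
    the extra factor [t ^ p.+1] is exactly the entry [alpha]. *)
Lemma two_value_circulant (R : realType) (p alpha : nat) (a t : R) :
  t ^+ p.+1 = alpha%:R ->
  forall k l : 'I_p.+1, two_value_mx p.+1 alpha a k l * t ^+ k =
    circulant_mx (fun d : 'I_p.+1 => if d == 0 then a else t ^+ d) k l * t ^+ l.
Proof.
move=> tm k l; rewrite !mxE subr_eq0.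
have [->//|kl] := eqVneq k l.
have kp := ltn_ord k; have lp := ltn_ord l.
rewrite -exprD val_ord_sub; case: ltnP => lk.
  by rewrite -tm -exprD subnK// ltnW// (leq_trans lp)// leq_addr.
by rewrite mul1r subnK.
Qed.

Theorem theorem5 (R : realType) (m alpha : nat) (a : R)
    (hm : (2 <= m)%N) (halpha : (0 < alpha)%N) (ha : 0 < a)
    (i j u v : 'I_m) :
  (fun n : nat => (two_value_mx m alpha a ^+ n) i j
                  / (two_value_mx m alpha a ^+ n) u v) @ \oo
    --> (alpha%:R : R)
          `^ ((j%:R + u%:R - i%:R - v%:R) / m%:R).
Proof.
case: m hm i j u v => [//|p] _ i j u v.
have al1 : 1 <= alpha%:R :> R by rewrite ler1n.
pose t : R := alpha%:R `^ (p.+1%:R)^-1.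
have t0 : 0 < t by rewrite powR_gt0 ?ltr0n.
have t1 : 1 <= t.
  by rewrite -(powRr0 alpha%:R) ler_powR// invr_ge0.
have tm : t ^+ p.+1 = alpha%:R.
  by rewrite -powR_mulrn ?(ltW t0)// /t -powRrM mulVf ?pnatr_eq0// powRr1.
pose w (d : 'I_p.+1) : R := if d == 0 then a else t ^+ d.
pose A := two_value_mx p.+1 alpha a; pose C := circulant_mx w.
(* The diagonal entries of [C] are [a] and the others are powers of [t >= 1], so [min a 1] is a
   positive lower bound for all of them. *)
have e0 : 0 < Num.min a 1 by rewrite lt_min ha ltr01.
have eC k l : Num.min a 1 <= C k l.
  rewrite mxE /w; case: ifP => _; first by rewrite ge_min lexx.
  by rewrite ge_min exprn_ege1 ?orbT.
have AC n k l : (A ^+ n) k l = (C ^+ n) k l * (t ^+ l / t ^+ k).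
  apply: (mulIf (x := t ^+ k)); first by rewrite expf_neq0 ?gt_eqF.
  rewrite (exprmx_diag_conj (x := fun k : 'I_p.+1 => t ^+ k)
    (two_value_circulant a tm)) -!mulrA mulVf ?mulr1//.
  by rewrite expf_neq0 ?gt_eqF.
have texp (k : nat) : t ^+ k = alpha%:R `^ (k%:R / p.+1%:R).
  by rewrite -powR_mulrn ?(ltW t0)// /t -powRrM mulrC.
(* The conjugation factors do not depend on [n]: they form the limit, while the ratio of entries of
   [C ^+ n] tends to [1]. *)
have -> : (fun n => (A ^+ n) i j / (A ^+ n) u v)
    = (fun n => (C ^+ n) i j / (C ^+ n) u v
                * (t ^+ j / t ^+ i / (t ^+ v / t ^+ u))).
  by apply/funext => n; rewrite !AC invfM mulrACA.
have al0 : alpha%:R != 0 :> R by rewrite pnatr_eq0 -lt0n.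
have -> : alpha%:R `^ ((j%:R + u%:R - i%:R - v%:R) / p.+1%:R)
    = 1 * (t ^+ j / t ^+ i / (t ^+ v / t ^+ u)) :> R.
  rewrite mul1r !texp -!powRB ?al0 ?implybT//; congr (_ `^ _); ring.
apply: cvgMr_tmp; apply: cvg_exprmx_entry_ratio e0 eC _ _ i j u v.
  exact: circulant_row_sum.
exact: circulant_col_sum.
Qed.
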